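(* Let $X$ be a set with $|X|=k\in\mathbb{N}\cup\{\infty\}$. Define numbers $d_{m,n,k}$ for $m,n\in\mathbb{N}$ with $m\le k$ by $d_{m,0,k}=1$ and, for $n\geq 1$, $$d_{m,n,k}=\begin{cases} m\cdot d_{m,n-1,k}+d_{m+1,n-1,k} & \text{if } m<k,\\ m\cdot d_{m,n-1,k} & \text{if } m=k.\end{cases}$$ Then for every $n\in\mathbb{N}$ the number of orbits of $X^n$ under the diagonal action of $S_k$ is $\left|X^n/S_k\right|=d_{0,n,k}$.
   Context: $S_k$ denotes the symmetric group of all permutations of the set $X$ (with $k=\infty$ when $X$ is infinite). The diagonal action is $\pi\cdot(x_1,\dots,x_n)=(\pi(x_1),\dots,\pi(x_n))$. *)

(* Defs.v *)
From mathcomp Require Import all_boot.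
From mathcomp Require Import boolp classical_sets functions cardinality.
Set Implicit Arguments.
Unset Strict Implicit.
Unset Printing Implicit Defensive.
Local Open Scope classical_set_scope.
Local Open Scope card_scope.

(* Elements of N u {oo}: [Some k] is the natural number k, [None] is oo. *)
Definition enat := option nat.

Definition lt_enat (m : nat) (k : enat) : bool :=
  if k is Some k' then m < k' else true.

(* |X| = k, where every infinite X, of whatever cardinality, has |X| = oo. *)
Definition has_card (X : Type) (k : enat) : Prop :=
  if k is Some k' then [set: X] #= `I_k' else infinite_set [set: X].

(* For m <= k the [else] branch is exactly the case m = k; the values at
   m > k are irrelevant, as the recursion never leaves the range m <= k. *)
Fixpoint dnum (m n : nat) (k : enat) : nat :=
  if n is n'.+1 then
    if lt_enat m k then m * dnum m n' k + dnum m.+1 n' k else m * dnum m n' k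
  else 1.

Definition sym (X : Type) : set (X -> X) := [set f | bijective f].

Definition diag_act (X : Type) (n : nat) (f : X -> X) (x : n.-tuple X) :
  n.-tuple X := map_tuple f x.

Definition diag_orbit (X : Type) (n : nat) (x : n.-tuple X) :
  set (n.-tuple X) := [set diag_act f x | f in @sym X].

Definition diag_orbits (X : Type) (n : nat) : set (set (n.-tuple X)) :=
  range (@diag_orbit X n).

(* Main.v *)
Require Import Defs.
From mathcomp Require Import all_boot.
From mathcomp Require Import boolp classical_sets functions cardinality.
Set Implicit Arguments.
Unset Strict Implicit.
Unset Printing Implicit Defensive.
Local Open Scope classical_set_scope.
Local Open Scope card_scope.

(** Reading a tuple from left to right, replace each entry by the rank of its
    first occurrence: an entry equal to the [i]-th distinct point met so far
    becomes [i], and a new point, met after [m] distinct ones, becomes [m].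
    The resulting word of numbers ([growth_code] with the empty list of known
    points) records exactly which entries of the tuple coincide.

    The word is unchanged by an injection acting on the entries
    ([growth_code_map]).  Conversely two tuples with the same word are related
    by a matching of their distinct points, and a bijection between two finite
    sets of points extends to a permutation of the whole set
    ([bijective_map_uniq]); so they lie in the same orbit
    ([growth_code_eq_bij]).  Hence the orbits are the nonempty fibres of the
    code, and it remains to count the words that occur.

    Once [m] distinct points are known, the next letter is one of the [m] old
    ranks, or [m] itself provided that a fresh point remains, that is, provided
    that [m < k].  In the first case [m] points are still known, in the second
    [m + 1]: this is the recursion of [dnum].  The list [growth_words] makes it
    concrete, and [growth_code_in_words] and [growth_words_code] say that it
    lists the words that occur. *)

Lemma card_seq_uniq (T : eqType) (s : seq T) :
  uniq s -> [set` s] #= `I_(size s).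
Proof.
move=> us.
have inj : {in [set` s] &, injective (index^~ s)}.
  by move=> x y; rewrite !inE /= => xs ys; apply: index_inj xs ys.
rewrite card_eq_sym -(card_eqr (inj_card_eq inj)).
suff -> : [set index x s | x in [set` s]] = `I_(size s) by exact: card_eqxx.
apply/seteqP; split => [_ [x /= xs <-]|i /= ilt]; first by rewrite index_mem.
case: s us ilt {inj} => // x0 s us ilt.
by exists (nth x0 (x0 :: s) i); [exact: mem_nth|exact: index_uniq].
Qed.

(** This lemma and the next tie the test [m < k] of the recursion to the
    existence of a point outside a list of [m] distinct ones. *)
Lemma fresh_lt_card (X : eqType) (k : enat) (s : seq X) (y : X) :
  has_card X k -> uniq s -> y \notin s -> lt_enat (size s) k.
Proof.
case: k => //= k cX us ys.
have uys : uniq (y :: s) by rewrite /= ys.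
rewrite -[_ < k]card_le_II -(card_le_eqr cX) -(card_le_eql (card_seq_uniq uys)).
exact: subset_card_le.
Qed.

Lemma lt_card_fresh (X : eqType) (k : enat) (s : seq X) :
  has_card X k -> uniq s -> lt_enat (size s) k -> exists y, y \notin s.
Proof.
move=> cX us ltk; apply: contrapT => /forallNP full.
have sT : [set: X] #= `I_(size s).
  suff -> : [set: X] = [set` s] by exact: card_seq_uniq.
  by apply/seteqP; split => // y _ /=; apply/negPn/negP/full.
case: k cX ltk => [k /= cX|cX _]; last by apply: cX; exists (size s).
suff -> : size s = k by rewrite ltnn.
by apply/card_eq_II; rewrite -(card_eql sT).
Qed.

Definition swap (X : eqType) (a b z : X) : X :=
  if z == a then b else if z == b then a else z.

Lemma swapK (X : eqType) (a b : X) : involutive (swap a b).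
Proof.
move=> z; rewrite /swap; have [->|za] := eqVneq z a.
  by rewrite eqxx; case: eqP.
have [->|zb] := eqVneq z b; first by rewrite eqxx.
by rewrite (negPf za) (negPf zb).
Qed.

(** The permutation is built one point at a time: a permutation matching the
    tails is corrected by a transposition, which fixes the points already
    placed.  This needs no count of the points outside the two lists, so it
    covers finite and infinite sets together. *)
Lemma bijective_map_uniq (X : eqType) (s t : seq X) :
  uniq s -> uniq t -> size s = size t ->
  exists2 f : X -> X, bijective f & map f s = t.
Proof.
elim: s t => [|b s IHs] [|c t] //=; first by exists id; first exact: inv_bij.
move=> /andP[bs us] /andP[ct ut] [/(IHs _ us ut)[f bij_f fs]].
exists (swap (f b) c \o f); first exact: bij_comp (inv_bij (swapK _ _)) bij_f.
rewrite map_comp fs /= /swap eqxx; congr (_ :: _).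
apply: map_id_in => z zt; rewrite ifN ?ifN //.
  by apply: contraNneq ct => <-.
apply: contraNneq bs => zfb.
by rewrite -(mem_map (bij_inj bij_f)) fs -zfb.
Qed.

(** The argument [s] lists the distinct points already met; the recursion
    changes it, so the properties of the code are stated for all [s]. *)
Fixpoint growth_code (X : eqType) (s x : seq X) : seq nat :=
  if x is y :: x' then
    index y s :: growth_code (if y \in s then s else rcons s y) x'
  else [::].

Lemma growth_code_map (X : eqType) (f : X -> X) (s x : seq X) :
  injective f -> growth_code (map f s) (map f x) = growth_code s x.
Proof.
move=> inj_f; elim: x s => //= y x IHx s.
by rewrite index_map // mem_map // -map_rcons; case: ifP => _; rewrite IHx.
Qed.

(** Equal codes make both lists meet fresh points at the same positions, so
    the known points of the one stay matched, in order, with those of the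
    other; when the lists are exhausted this matching extends to a
    permutation. *)
Lemma growth_code_eq_bij (X : eqType) (s t x y : seq X) :
  uniq s -> uniq t -> size s = size t -> growth_code s x = growth_code t y ->
  exists2 f : X -> X, bijective f & map f s = t /\ map f x = y.
Proof.
elim: x s t y => [|a x IHx] s t [|b y] //= us ut st.
  by have [f bij_f fs] := bijective_map_uniq us ut st; exists f.
move=> [iab]; have : (a \in s) = (b \in t) by rewrite -!index_mem iab st.
case: ifPn => [as_ bt|as_ bt]; rewrite -bt.
  move=> /(IHx _ _ _ us ut st)[f bij_f [fs fx]]; exists f => //; split=> //.
  rewrite /= fx; congr (_ :: _).
  by rewrite -(nth_index a as_) -(nth_map a b) ?index_mem// fs iab nth_index -?bt.
move=> /IHx[|||f bij_f []]; rewrite ?rcons_uniq ?as_ -?bt ?size_rcons ?st//.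
by rewrite map_rcons => /rcons_inj[fs fa] fx; exists f; rewrite //= fa fx.
Qed.

(** Candidates for the codes of lists of length [n] read after [m] distinct
    points; the two parts separate the words by whether their first letter
    repeats an old point or announces a fresh one, as in [dnum]. *)
Fixpoint growth_words (m n : nat) (k : enat) : seq (seq nat) :=
  if n is n'.+1 then
    [seq i :: w | i <- iota 0 m, w <- growth_words m n' k] ++
    (if lt_enat m k then [seq m :: w | w <- growth_words m.+1 n' k] else [::])
  else [:: [::]].

Lemma size_growth_words (m n : nat) (k : enat) :
  size (growth_words m n k) = dnum m n k.
Proof.
elim: n m => //= n IHn m; rewrite size_cat size_allpairs size_iota IHn.
by case: ifP => _; rewrite ?size_map ?IHn// addn0.
Qed.

Lemma uniq_growth_words (m n : nat) (k : enat) : uniq (growth_words m n k).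
Proof.
elim: n m => //= n IHn m; rewrite cat_uniq; apply/and3P; split.
- by apply: allpairs_uniq => [||[i w] [j v] _ _ /= [-> ->]] //; exact: iota_uniq.
- apply/hasPn => v; case: ifP => // _ /mapP[w _ ->].
  by apply/allpairsP => -[[i u] /= [im _ [mi _]]]; rewrite -mi mem_iota ltnn in im.
- by case: ifP => // _; rewrite map_inj_uniq // => u v [].
Qed.

Lemma growth_code_in_words (X : eqType) (k : enat) (s x : seq X) :
  has_card X k -> uniq s ->
  growth_code s x \in growth_words (size s) (size x) k.
Proof.
move=> cX; elim: x s => //= y x IHx s us; rewrite mem_cat; apply/orP.
case: ifPn => ys.
  by left; apply: allpairs_f; rewrite ?IHx// mem_iota index_mem.
right; rewrite (fresh_lt_card cX us ys) (memNindex ys) -(size_rcons s y) map_f//.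
by rewrite IHx// rcons_uniq ys.
Qed.

Lemma growth_words_code (X : eqType) (k : enat) (n : nat) (s : seq X)
    (w : seq nat) :
  has_card X k -> uniq s -> w \in growth_words (size s) n k ->
  exists2 x : seq X, size x = n & growth_code s x = w.
Proof.
move=> cX; elim: n s w => [|n IHn] s w us /=.
  by rewrite inE => /eqP->; exists [::].
rewrite mem_cat => /orP[/allpairsP[[i v] /= [im vw ->]]|].
  have [x xn xv] := IHn s v us vw.
  rewrite mem_iota in im; have x0 : X by case: (s) im.
  exists (nth x0 s i :: x); first by rewrite /= xn.
  by rewrite /= (index_uniq x0) ?mem_nth ?xv.
case: ifP => // ltk /mapP[v vw ->].
have [y ys] := lt_card_fresh cX us ltk.
have [||x xn xv] := IHn (rcons s y) v; rewrite ?rcons_uniq ?ys ?size_rcons//.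
by exists (y :: x); rewrite /= ?xn// (negPf ys) (memNindex ys) xv.
Qed.

Lemma diag_orbit_fibre (X : eqType) (n : nat) (x : n.-tuple X) :
  diag_orbit x =
  [set y : n.-tuple X | growth_code [::] y = growth_code [::] x].
Proof.
apply/seteqP; split => [_ [f /bij_inj inj_f <-]|y /= /esym xy].
  exact: (growth_code_map [::] x inj_f).
have [//|//|//|f bij_f [_ fx]] := growth_code_eq_bij _ _ _ xy.
by exists f => //; apply: val_inj.
Qed.

Lemma card_diag_orbits (X : eqType) (k : enat) (n : nat) :
  has_card X k -> @diag_orbits X n #= `I_(dnum 0 n k).
Proof.
move=> cX; set W := growth_words 0 n k.
pose fibre w := [set y : n.-tuple X | growth_code [::] y = w].
have fibreN0 w : w \in W -> exists x : n.-tuple X, growth_code [::] x = w.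
  move=> /(@growth_words_code X k n [::] w cX isT)[x /eqP xn xw].
  by exists (Tuple xn).
have orbitsE : @diag_orbits X n = [set fibre w | w in [set` W]].
  apply/seteqP; split => [_ [x _ <-]|_ [w /= /fibreN0[x <-] <-]].
    exists (growth_code [::] x); last by rewrite diag_orbit_fibre.
    have := growth_code_in_words x cX (isT : uniq [::]).
    by rewrite size_tuple.
  by exists x => //; rewrite diag_orbit_fibre.
(* Distinct words have distinct fibres because these are nonempty. *)
have inj : {in [set` W] &, injective fibre}.
  move=> v w; rewrite !inE /= => /fibreN0[x <-] _ eq_fib.
  by have : fibre (growth_code [::] x) x by []; rewrite eq_fib.
rewrite orbitsE (card_eql (inj_card_eq inj)) -size_growth_words.
exact: card_seq_uniq (uniq_growth_words 0 n k).
Qed.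

Theorem theorem4p17 (X : Type) (k : enat) (n : nat) (hX : has_card X k) :
  @diag_orbits X n #= `I_(dnum 0 n k).
Proof. exact: (@card_diag_orbits {classic X} k n hX). Qed.
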